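(* Let $\{X_i\}_{i\in\mathbb{Z}}$ be an admissible inverse system with inverse limit $(X_\infty,\bar d_\infty)$. Then there is a $1$-Lipschitz map $\phi:X_\infty\to\mathbb{R}$, canonical up to post-composition with a translation (namely, $\phi$ is the map induced by the compatible system of direction preserving, edge-linear maps $\phi_i:X_i\to\mathbb{R}$ described in the context, which is unique up to post-composition with a translation), and a constant $C\in(0,\infty)$, such that for every interval $I\subset\mathbb{R}$ the $\operatorname{diam}(I)$-components of $\phi^{-1}(I)$ have diameter at most $C\cdot\operatorname{diam}(I)$.
   Context: Graphs are identified with their geometric realizations; they need not be connected or have finite valence, and may contain isolated vertices. An inverse system of maps $\pi_i:X_{i+1}\to X_i$, $i\in\mathbb{Z}$, is admissible if for some integer $m\ge2$: (1) each $X_i$ is a nonempty directed graph; (2) if $X_i'$ is the directed graph obtained by subdividing each edge of $X_i$ into $m$ edges, then $\pi_i$ induces a map $X_{i+1}\to X_i'$ which is simplicial, an isomorphism on every edge, and direction preserving; (3) for all $i,j\in\mathbb{Z}$, $x\in X_i$, $x'\in X_j$, there is $k\le\min(i,j)$ such that $x,x'$ project to the same connected component of $X_k$. $X_\infty$ is the inverse limit, with projections $\pi_i^\infty:X_\infty\to X_i$. Each edge of $X_i$ is identified linearly with an interval of length $m^{-i}$. For a vertex $v$ of $X_i$, the closed star $\operatorname{St}(v,X_i)$ is the union of $\{v\}$ and all edges of $X_i$ containing $v$. $\bar d_\infty$ is the supremal pseudo-distance on $X_\infty$ such that for every $i\in\mathbb{Z}$ and vertex $v\in X_i$, $(\pi_i^\infty)^{-1}(\operatorname{St}(v,X_i))$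 has diameter at most $2m^{-i}$ (it is a metric). The maps $\phi_i:X_i\to\mathbb{R}$, $i\in\mathbb{Z}$, are required to be compatible ($\phi_{i+1}=\phi_i\circ\pi_i$), direction preserving, and linear on each edge of $X_i$ with image a segment of length $m^{-i}$; the induced map is $\phi=\phi_i\circ\pi_i^\infty$ (independent of $i$). For $\delta>0$, the $\delta$-components of a metric space are the equivalence classes of the relation: $z\sim z'$ iff there is a finite sequence $z=z_0,\dots,z_k=z'$ with $d(z_{i-1},z_i)\le\delta$ for all $i$. The condition on $I$ is only nontrivial for bounded intervals of positive length. *)

(* Defs.v *)
From mathcomp Require Import all_boot all_order all_algebra.
From mathcomp Require Import all_classical all_reals all_analysis.
From Stdlib Require Import Relation_Operators.

Set Implicit Arguments.
Unset Strict Implicit.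
Unset Printing Implicit Defensive.
Import Order.TTheory GRing.Theory Num.Theory.

Local Open Scope classical_set_scope.
Local Open Scope ring_scope.

(* Loops and multiple edges are allowed here; loops cannot occur in an
   admissible system, since a subdivision into m >= 2 pieces has none. *)
Record digraph := Digraph {
  vertex : Type;
  edge : Type;
  src : edge -> vertex;
  tgt : edge -> vertex }.

Record digraph_hom (G H : digraph) := DigraphHom {
  hom_vertex : vertex G -> vertex H;
  hom_edge : edge G -> edge H;
  hom_src : forall e, src (hom_edge e) = hom_vertex (src e);
  hom_tgt : forall e, tgt (hom_edge e) = hom_vertex (tgt e) }.

Section Realization.
Variable R : realType.

(* A point of the geometric realization is a vertex or a point of exactly one
   open edge, with parameter in the open unit interval (from src to tgt). *)
Inductive realization (G : digraph) : Type :=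
| Vertex of vertex G
| Inner of edge G & {t : R | 0 < t < 1}.

(* The characteristic map of an edge; it is meant for 0 <= t <= 1. *)
Definition edge_point (G : digraph) (e : edge G) (t : R) : realization G :=
  if insub t is Some t' then Inner e t'
  else if t <= 0 then Vertex (src e) else Vertex (tgt e).

Definition closed_edge (G : digraph) (e : edge G) : set (realization G) :=
  [set edge_point e t | t in `[0, 1]].

Definition star (G : digraph) (v : vertex G) : set (realization G) :=
  [set Vertex v] `|`
  \bigcup_(e in [set e | src e = v \/ tgt e = v]) closed_edge e.

Definition realize (G H : digraph) (f : digraph_hom G H)
    (x : realization G) : realization H :=
  match x with
  | Vertex v => Vertex (hom_vertex f v)
  | Inner e t => Inner (hom_edge f e) t
  end.

Definition same_component (G : digraph) : realization G -> realization G -> Prop :=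
  clos_refl_sym_trans _
    (fun x y => exists e : edge G, closed_edge e x /\ closed_edge e y).

End Realization.

Section Subdivision.
Variables (m : nat) (G : digraph).

(* [inr (e, j)] is the new vertex of e at parameter j.+1 / m. *)
Definition subdiv_vertex : Type := vertex G + edge G * 'I_m.-1.

(* The point of e at parameter k / m, for 0 <= k <= m. *)
Definition division_vertex (e : edge G) (k : nat) : subdiv_vertex :=
  if k is k'.+1 then
    if insub k' is Some j then inr (e, j) else inl (tgt e)
  else inl (src e).

Definition subdiv : digraph :=
  @Digraph subdiv_vertex (edge G * 'I_m)
    (fun ej => division_vertex ej.1 ej.2)
    (fun ej => division_vertex ej.1 ej.2.+1).

(* The identification of the realization of the subdivision with that of G. *)
Definition subdiv_point (R : realType) (x : realization R subdiv) :
    realization R G :=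
  match x with
  | Vertex (inl v) => Vertex R v
  | Vertex (inr (e, j)) => edge_point e (j.+1%:R / m%:R)
  | Inner (e, j) t => edge_point e ((j%:R + val t) / m%:R)
  end.

End Subdivision.

Section InverseSystem.
Variables (R : realType) (X : int -> digraph).
Variable pr : forall i : int, realization R (X (i + 1)) -> realization R (X i).

(* [projects_to x y], for x in X i and y in X k: k <= i and the composite of
   the maps pr from X i to X k sends x to y. *)
Inductive projects_to (i : int) (x : realization R (X i)) :
    forall k : int, realization R (X k) -> Prop :=
| projects_refl : projects_to x x
| projects_step (k : int) (y : realization R (X (k + 1))) :
    projects_to x y -> projects_to x (pr y).

Definition admissible (m : nat) : Prop :=
  [/\ (2 <= m)%N,
      forall i, inhabited (realization R (X i)),
      forall i, exists f : digraph_hom (X (i + 1)) (subdiv m (X i)),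
        forall x, pr x = subdiv_point (realize f x)
    & forall (i j : int) (x : realization R (X i)) (x' : realization R (X j)),
        exists2 k : int, k <= Num.min i j &
        exists y y' : realization R (X k),
          [/\ projects_to x y, projects_to x' y' & same_component y y']].

Definition inverse_limit : Type :=
  {x : forall i, realization R (X i) | forall i, pr (x (i + 1)) = x i}.

Definition limit_proj (i : int) (x : inverse_limit) : realization R (X i) :=
  sval x i.

End InverseSystem.

Section Metric.
Variables (R : realType) (T : Type) (d : T -> T -> R).

Definition pseudo_distance : Prop :=
  [/\ forall x y, 0 <= d x y,
      forall x, d x x = 0,
      forall x y, d x y = d y x
    & forall x y z, d x z <= d x y + d y z].

Definition diam (A : set T) : \bar R :=
  ereal_sup [set (d x y)%:E | x in A & y in A].

(* The delta-component of x in the subspace A, for x in A. *)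
Definition delta_component (delta : \bar R) (A : set T) (x : T) : set T :=
  [set y | exists (k : nat) (z : nat -> T),
    [/\ z 0%N = x, z k = y,
        forall j, (j <= k)%N -> A (z j)
      & forall j, (j < k)%N -> ((d (z j) (z j.+1))%:E <= delta)%E]].

End Metric.

Section LimitMetric.
Variables (R : realType) (m : nat) (X : int -> digraph).
Variable pr : forall i : int, realization R (X (i + 1)) -> realization R (X i).

Definition star_bounded (d : inverse_limit pr -> inverse_limit pr -> R) : Prop :=
  forall (i : int) (v : vertex (X i)),
    (diam d (limit_proj i @^-1` star v) <= (2 * m%:R ^ (- i))%:E)%E.

(* In an admissible system the set below is bounded above: x and y project into
   a common star of X i for i sufficiently negative. *)
Definition dbar (x y : inverse_limit pr) : R :=
  sup [set d x y | d in [set d | pseudo_distance d /\ star_bounded d]].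

End LimitMetric.

Arguments dbar {R} m {X} pr x y.

Section Height.
Variables (R : realType) (m : nat) (X : int -> digraph).
Variable pr : forall i : int, realization R (X (i + 1)) -> realization R (X i).

Definition linear_on_edges (G : digraph) (f : realization R G -> R) : Prop :=
  forall (e : edge G) (t : R), 0 <= t <= 1 ->
    f (edge_point e t) = (1 - t) * f (Vertex R (src e)) + t * f (Vertex R (tgt e)).

Definition height_system (phi : forall i : int, realization R (X i) -> R) : Prop :=
  [/\ forall i (x : realization R (X (i + 1))), phi (i + 1) x = phi i (pr x),
      forall i, linear_on_edges (phi i),
      forall i (e : edge (X i)),
        phi i (Vertex R (src e)) < phi i (Vertex R (tgt e))
    & forall i (e : edge (X i)),
        `|phi i (Vertex R (tgt e)) - phi i (Vertex R (src e))| = m%:R ^ (- i)].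

End Height.

(* Main.v *)
Require Import Defs.
From mathcomp Require Import all_boot all_order all_algebra.
From mathcomp Require Import all_classical all_reals all_analysis.
From mathcomp Require Import ring lra zify.
From Stdlib Require Import Relation_Operators.
Import Order.TTheory GRing.Theory Num.Theory.

Local Open Scope classical_set_scope.
Local Open Scope ring_scope.

Set Implicit Arguments.
Unset Strict Implicit.
Unset Printing Implicit Defensive.

(** The height. An edge of X_i lies over a subsegment of an edge of X_k for every
k <= i (thread_edge), so a point of X_i has, in each X_k below it, a position
along an edge which is its height modulo the edge length m^(-k). Edge lengths
tend to infinity as k decreases, so a real number is determined by its residues
modulo m^(-k) for all small k: two points have at most one height difference
compatible with all their positions (height_gap). Two points always have such a
difference: they project to one component of some X_k, differences along an edge
are visible, and differences add up along a path. In particular no cycle obstructs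
the construction: the total height around it is divisible by arbitrarily large
powers of m, hence zero. The maps phi_i are the differences to a base point, and
they are unique up to a constant because edges determine all differences.

The distance. dbar is a supremum, so every pseudo-distance that respects the
star bounds is a lower bound for it. Functions f on the limit that vary by at most
m^(-i) from a central value on each star of X_i give such pseudo-distances
|f x - f y|. The height is one of them, which is the Lipschitz bound. The others
that matter are the tents: for a vertex v of X_i, the edge-linear function that
is m^(-i) at v and 0 at the other vertices (dbar_ge_tent; tent v itself is
normalized to be 1 at v). Tents also show that
dbar is a supremum of a bounded set: if v is the vertex of X_k nearest to the
projection of x, the tent of v is at least m^(-k)/2 there, and for small k this is
more than the length of a given path from x to y, so the tent is still positive at
y and both points lie over the star of v (common_star).

The components. Let the heights in I differ by at most r, and let 4 r < m^(-i).
For a point x over I let v be a vertex of X_i nearest to its projection. On the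
open star of v the tent is m^(-i) - |phi - phi(v)|, so as long as a chain of steps
at most r over I stays in the open star, its tent value is at least
m^(-i)/2 - r > r; the next step changes the tent by at most r and cannot leave the
star. Hence the whole component lies over one star of X_i and has diameter at most
2 m^(-i) (component_star), and i can be chosen with m^(-i) comparable to r, up to
a factor 4 m. *)

Lemma int_descending_ind (P : int -> Prop) (i : int) :
  P i -> (forall k, k < i -> P (k + 1) -> P k) -> forall k, k <= i -> P k.
Proof.
move=> Pi IH k ki; have -> : k = i - `|i - k|%N%:Z by lia.
elim: `|i - k|%N => [|n IHn]; first by rewrite subr0.
by apply: IH; [lia | rewrite (_ : _ + 1 = i - n%:Z)//; lia].
Qed.

(** * Points of edges and tent functions *)

Section OneGraph.
Variables (R : realType) (G : digraph).
Implicit Types (e : edge G) (v : vertex G) (a : realization R G).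

Lemma edge_point0 e : edge_point e 0 = Vertex R (src e).
Proof. by rewrite /edge_point insubF ?lexx// ltxx. Qed.

Lemma edge_point1 e : edge_point e 1 = Vertex R (tgt e).
Proof. by rewrite /edge_point insubF ?ltxx ?andbF// ler10. Qed.

Lemma edge_point_val e (t : {t : R | 0 < t < 1}) :
  edge_point e (val t) = Inner e t.
Proof. by rewrite /edge_point valK. Qed.

Lemma edge_point_ind (P : R -> realization R G -> Prop) e :
  P 0 (Vertex R (src e)) -> P 1 (Vertex R (tgt e)) ->
  (forall t, P (val t) (Inner e t)) ->
  forall t, 0 <= t <= 1 -> P t (edge_point e t).
Proof.
move=> P0 P1 Pt t; rewrite !le_eqVlt => /andP[/predU1P[<-|t0]]; first by rewrite edge_point0.
move=> /predU1P[->|t1]; first by rewrite edge_point1.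
have t01 : 0 < t < 1 by rewrite t0.
by have := Pt (exist _ t t01); rewrite -edge_point_val.
Qed.

Lemma inner_itv (t : {t : R | 0 < t < 1}) : 0 <= val t <= 1.
Proof. by case: t => t /= /andP[t0 t1]; rewrite !ltW. Qed.

Lemma linear_on_edgesB (f : realization R G -> R) e (t t' : R) :
  linear_on_edges f -> 0 <= t <= 1 -> 0 <= t' <= 1 ->
  f (edge_point e t) - f (edge_point e t') =
  (t - t') * (f (Vertex R (tgt e)) - f (Vertex R (src e))).
Proof. by move=> fl t01 t'01; rewrite !fl//; lra. Qed.

(** The edge-linear extension of the indicator function of v. *)
Definition tent (v : vertex G) (a : realization R G) : R :=
  match a with
  | Vertex u => `[< u = v >]%:R
  | Inner e t =>
      (1 - val t) * `[< src e = v >]%:R + val t * `[< tgt e = v >]%:R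
  end.

Lemma tent_linear v : linear_on_edges (tent v).
Proof.
move=> e; apply: (edge_point_ind (P := fun t a => tent v a =
  (1 - t) * tent v (Vertex R (src e)) + t * tent v (Vertex R (tgt e)))) => //=.
- by rewrite subr0 mul1r mul0r addr0.
- by rewrite subrr mul1r mul0r add0r.
Qed.

Lemma tent_itv v a : 0 <= tent v a <= 1.
Proof.
case: a => [u|e [t /= /andP[t0 t1]]] /=; first by rewrite ler0n lern1 leq_b1.
by case: asboolP => _; case: asboolP => _ /=; rewrite ?mulr1 ?mulr0; lra.
Qed.

Lemma tent_lipschitz v e (t t' : R) : 0 <= t <= 1 -> 0 <= t' <= 1 ->
  `|tent v (edge_point e t) - tent v (edge_point e t')| <= `|t - t'|.
Proof.
move=> t01 t'01; rewrite (linear_on_edgesB _ (tent_linear v))// normrM.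
rewrite ler_piMr//= ler_norml.
by case: asboolP => _; case: asboolP => _; rewrite /=; lra.
Qed.

Lemma tent_gt0_star v a : 0 < tent v a -> star v a.
Proof.
case: a => [u|e t] /=.
  by case: asboolP => [->|_]; [left | rewrite ltxx].
move=> h; right; exists e.
  move: h => /=; case: asboolP => [|_]; first by left.
  by case: asboolP => [|_]; [right | rewrite !mulr0 addr0 ltxx].
by exists (val t); [rewrite /= in_itv /=; exact: inner_itv | exact: edge_point_val].
Qed.

(** Every point of an edge is within half of the edge of one of its endpoints. *)
Lemma near_vertex a : exists v, 1 / 2 <= tent v a.
Proof.
case: a => [u|e t]; first by exists u; rewrite /= asboolT//=; lra.
case: t => t t01; have [t_le|t_gt] := leP t (1 / 2).
  by exists (src e); rewrite /= asboolT//; case: asboolP => _ /=; lra.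
exists (tgt e); rewrite /= [`[< tgt e = _ >]]asboolT//.
by case: asboolP => _ /=; lra.
Qed.

(** The position along the edge containing a; only its class modulo 1 is used, so
the value 0 at a vertex serves for both ends of an edge. *)
Definition edge_param a : R := if a is Inner _ t then val t else 0.

Lemma edge_param_edge_point e (t : R) : 0 <= t <= 1 ->
  t - edge_param (edge_point e t) \is a Num.int.
Proof.
move: t; apply: (edge_point_ind (P := fun t a => t - edge_param a \is a Num.int)) => [||t] /=;
  by rewrite ?subr0 ?subrr ?rpred0 ?rpred1.
Qed.

End OneGraph.

(** * Threads of projections *)

Section Projections.
Variables (R : realType) (X : int -> digraph).
Variable pr : forall i : int, realization R (X (i + 1)) -> realization R (X i).

(** Only the values z k with k <= i are meaningful. Total families avoid both
partial functions and transports between the types realization R (X k); a point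
of the limit is a thread at every level. *)
Definition thread (i : int) (z : forall k, realization R (X k)) : Prop :=
  forall k, k < i -> pr (z (k + 1)) = z k.

Lemma threadW (i j : int) z : j <= i -> thread i z -> thread j z.
Proof. by move=> ji zi k kj; apply/zi/(lt_le_trans kj). Qed.

Lemma thread_proj (i : int) (x : inverse_limit pr) :
  thread i (fun k => limit_proj k x).
Proof. by move=> k _; exact: (svalP x). Qed.

Lemma thread_eq (i : int) z z' : thread i z -> thread i z' -> z i = z' i ->
  forall k, k <= i -> z k = z' k.
Proof.
move=> zt zt' zz'; apply: int_descending_ind => // k ki IH.
by rewrite -zt// -zt'// IH.
Qed.

Lemma projects_to_thread (i : int) (x : realization R (X i)) (k : int)
    (y : realization R (X k)) : projects_to pr x y ->
  forall z, thread i z -> z i = x -> k <= i /\ z k = y.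
Proof.
elim => {k y} [|k y _ IH] z zt zi; first by [].
have [ki zk] := IH z zt zi; split; first by apply: le_trans ki; lia.
by rewrite -zk zt//; lia.
Qed.

(** Projections need not be surjective, so a point of X_i may fail to lift to the
limit; its projections to the lower levels always exist. *)
Lemma thread_exists : (forall i, inhabited (realization R (X i))) ->
  forall (i : int) (x : realization R (X i)),
  exists2 z, thread i z & z i = x.
Proof.
move=> inh i x.
have pt k : realization R (X k).
  by have /cid[y _] : exists y : realization R (X k), True
    by case: (inh k) => y; exists y.
have shift k n : k + n.+1%:Z = i -> k + 1 + n%:Z = i by move=> <-; lia.
have stop k : k + 0%:Z = i -> i = k by move=> <-; rewrite addr0.
(* The recursion goes down to level k from level k + n, and the equation
   k + n = i is carried along so that a single transport at the top suffices. *)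
pose descend := fix descend n : forall k, k + n%:Z = i -> realization R (X k) :=
  match n with
  | 0 => fun k E => eq_rect i (fun j => realization R (X j)) x k (stop k E)
  | n'.+1 => fun k E => pr (descend n' (k + 1) (shift k n' E))
  end.
have descend_irr n n' k (E : k + n%:Z = i) (E' : k + n'%:Z = i) :
    descend n k E = descend n' k E'.
  have nn' : n = n' by lia.
  by subst n'; rewrite (eq_irrelevance E E').
pose z k := if pselect (k + `|i - k|%N%:Z = i) is left E then descend _ k E
            else pt k.
have zE n k (E : k + n%:Z = i) : z k = descend n k E.
  rewrite /z; case: pselect => [E'|]; first exact: descend_irr.
  by case; lia.
exists z => [k ki|].
  have E : k + `|(i - (k + 1))%R|%N.+1%:Z = i by lia.
  by rewrite (zE _ _ E) /= -zE.
have E : i + 0%:Z = i by rewrite addr0.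
by rewrite (zE _ _ E) /= (eq_irrelevance (stop i E) erefl).
Qed.

End Projections.

(** * Projections along edges *)

Section Subdivision.
Variables (R : realType) (m : nat) (G H : digraph).
Hypothesis m_gt0 : (0 < m)%N.

Lemma subdiv_point_division (e : edge G) (k : nat) : (k <= m)%N ->
  subdiv_point (@Vertex R (subdiv m G) (division_vertex m e k)) = edge_point e (k%:R / m%:R).
Proof.
case: k => [|k] km /=; first by rewrite mul0r edge_point0.
case: insubP => [j _ /= ->//|].
rewrite -leqNgt => mk; rewrite (_ : k.+1 = m); last by lia.
by rewrite divff ?edge_point1// pnatr_eq0; lia.
Qed.

Lemma subdiv_edge (f : digraph_hom H (subdiv m G)) (e : edge H) :
  exists (e' : edge G) (j : 'I_m), forall t : R, 0 <= t <= 1 ->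
    subdiv_point (realize f (edge_point e t)) =
    edge_point e' ((j%:R + t) / m%:R).
Proof.
case fe : (hom_edge f e) => [e' j]; exists e', j => t.
apply: (edge_point_ind (P := fun t a => subdiv_point (realize f a) =
  edge_point e' ((j%:R + t) / m%:R))) => [||s].
- rewrite addr0 -subdiv_point_division; last exact: ltnW.
  by rewrite /= -hom_src fe.
- rewrite natr1 -subdiv_point_division//.
  by rewrite /= -hom_tgt fe.
- by rewrite /= fe.
Qed.

End Subdivision.

Section System.
Variables (R : realType) (m : nat) (X : int -> digraph).
Variable pr : forall i : int, realization R (X (i + 1)) -> realization R (X i).
Hypothesis Xadm : admissible pr m.

Let m_ge2 : (2 <= m)%N. Proof. by case: Xadm. Qed.

Let points i : inhabited (realization R (X i)).
Proof. by case: Xadm. Qed.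

Definition edge_length (i : int) : R := m%:R ^ (- i).

Lemma edge_length_gt0 i : 0 < edge_length i.
Proof. by rewrite exprz_gt0// ltr0n; lia. Qed.

Lemma edge_lengthS i : edge_length i = m%:R * edge_length (i + 1).
Proof.
have mu : m%:R \is a @GRing.unit R by rewrite unitfE pnatr_eq0; lia.
by rewrite /edge_length -[X in X * _]expr1z -exprzDr//; congr (_ ^ _); lia.
Qed.

Lemma edge_length_le i j : i <= j -> edge_length j <= edge_length i.
Proof. by move=> ij; rewrite ler_eXz2l ?lerN2// ltr1n. Qed.

(** This is why congruences modulo the edge lengths of all coarse levels determine a
real number, and why a fixed path becomes short compared to coarse edges. *)
Lemma edge_length_unbounded (r : R) :
  exists K, forall k, k <= K -> r < edge_length k.
Proof.
exists (- (Num.bound `|r|)%:Z) => k kK; apply: lt_le_trans (edge_length_le kK).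
rewrite /edge_length opprK -exprnP -natrX.
have /lt_trans -> // : r < (Num.bound `|r|)%:R.
  by apply: le_lt_trans (ler_norm r) _; exact: archi_boundP (normr_ge0 r).
by rewrite ltr_nat ltn_expl.
Qed.

Lemma edge_length_bracket (r : R) : 0 < r ->
  exists i, r <= edge_length i < m%:R * r.
Proof.
move=> r0; have lnm : 0 < ln (m%:R : R) by rewrite ln_gt0// ltr1n.
have m0 : 0 < m%:R :> R by rewrite ltr0n; lia.
pose n := Num.ceil (ln r / ln m%:R); exists (- n).
have lenE : edge_length (- n) = expR (n%:~R * ln m%:R).
  by rewrite /edge_length opprK -powR_intmul ?ltW// /powR gt_eqF.
rewrite lenE -{1 2}[r]lnK ?posrE// -[X in _ < X * _]lnK ?posrE// -expRD ler_expR ltr_expR.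
have := ceil_itv (ln r / ln m%:R); rewrite -/n intrB => /andP[lt_n le_n].
rewrite -ler_pdivrMr// le_n/= addrC -ltrBlDr.
by rewrite -[X in _ - X]mul1r -mulrBl -ltr_pdivlMr.
Qed.

(** Both points are kept on the same edge f of X_k: by induction on i - k, an edge
of X_i is carried onto one piece of a subdivided edge. *)
Lemma thread_edge (i : int) z z' (e : edge (X i)) (t t' : R) :
  thread pr i z -> thread pr i z' ->
  z i = edge_point e t -> z' i = edge_point e t' ->
  0 <= t <= 1 -> 0 <= t' <= 1 ->
  forall k, k <= i -> exists (f : edge (X k)) (s s' : R),
    [/\ z k = edge_point f s, z' k = edge_point f s',
        0 <= s <= 1, 0 <= s' <= 1
      & edge_length k * (s - s') = edge_length i * (t - t')].
Proof.
move=> zt zt' ze ze' t01 t'01; apply: int_descending_ind; first by exists e, t, t'.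
move=> k ki [f [s [s' [zs zs' s01 s'01 ss']]]].
have [_ _ /(_ k)[h prE] _] := Xadm.
have m_gt0 : (0 < m)%N by lia.
have m0 : 0 < m%:R :> R by rewrite ltr0n.
have [f' [j fE]] := subdiv_edge R m_gt0 h f.
have j01 (u : R) : 0 <= u <= 1 -> 0 <= (j%:R + u) / m%:R <= 1.
  move=> /andP[u0 u1]; rewrite divr_ge0 ?addr_ge0//=.
  rewrite ler_pdivrMr// mul1r (@le_trans _ _ (j%:R + 1))// ?lerD2l//.
  by rewrite natr1 ler_nat.
exists f', ((j%:R + s) / m%:R), ((j%:R + s') / m%:R); split; [| |exact: j01|exact: j01|].
- by rewrite -zt// zs prE fE.
- by rewrite -zt'// zs' prE fE.
- by rewrite edge_lengthS -ss'; field; rewrite gt_eqF.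
Qed.

(** Tents of X_k are 1-Lipschitz along the much shorter edges of X_i. *)
Lemma thread_tent (i : int) z z' (e : edge (X i)) (t t' : R) :
  thread pr i z -> thread pr i z' ->
  z i = edge_point e t -> z' i = edge_point e t' ->
  0 <= t <= 1 -> 0 <= t' <= 1 ->
  forall k (v : vertex (X k)), k <= i ->
    edge_length k * `|tent v (z k) - tent v (z' k)| <=
    edge_length i * `|t - t'|.
Proof.
move=> zt zt' ze ze' t01 t'01 k v ki.
have [f [s [s' [-> -> s01 s'01 ss']]]] :=
  thread_edge zt zt' ze ze' t01 t'01 ki.
have norm_len j u : edge_length j * `|u| = `|edge_length j * u|.
  by rewrite normrM gtr0_norm ?edge_length_gt0.
rewrite [leRHS]norm_len -ss' -norm_len.
by rewrite ler_pM2l ?edge_length_gt0// tent_lipschitz.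
Qed.

(** * Height differences *)

Let int_num_eq (u v : R) : u \is a Num.int -> v = u -> v \is a Num.int.
Proof. by move=> + ->. Qed.

(** r is a height difference of z and z' when, in every sufficiently coarse X_k,
it agrees with the difference of their positions modulo the edge length. *)
Definition height_gap (z z' : forall k, realization R (X k)) (r : R) : Prop :=
  exists K, forall k, k <= K ->
    r / edge_length k - (edge_param (z k) - edge_param (z' k)) \is a Num.int.

(** The difference of two candidates is an integer multiple of every large edge
length, hence zero. *)
Lemma height_gap_uniq z z' r r' :
  height_gap z z' r -> height_gap z z' r' -> r = r'.
Proof.
move=> [K zK] [K' zK']; have [L rL] := edge_length_unbounded `|r - r'|.
pose k := Num.min L (Num.min K K').
have [kL kK kK'] : [/\ k <= L, k <= K & k <= K'] by rewrite /k; split; lia.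
have len0 := edge_length_gt0 k.
have rint : (r - r') / edge_length k \is a Num.int.
  by apply: int_num_eq (rpredB (zK _ kK) (zK' _ kK')) _; lra.
apply/eqP; rewrite -subr_eq0; apply/negPn/negP => rr'.
have := norm_intr_ge1 rint; rewrite mulf_eq0 invr_eq0 (gt_eqF len0) orbF => /(_ rr').
rewrite normrM normfV (gtr0_norm len0) ler_pdivlMr// mul1r leNgt.
by rewrite (rL _ kL).
Qed.

Lemma height_gap_eventually z1 z2 z1' z2' r K :
  (forall k, k <= K -> z1 k = z2 k) -> (forall k, k <= K -> z1' k = z2' k) ->
  height_gap z1 z1' r -> height_gap z2 z2' r.
Proof.
move=> zz zz' [L zL]; exists (Num.min K L) => k kKL.
by rewrite -zz ?zL -?zz' ?zL//; lia.
Qed.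

Lemma height_gap0 z : height_gap z z 0.
Proof. by exists 0 => k _; rewrite mul0r subrr subr0 rpred0. Qed.

Lemma height_gapN z z' r : height_gap z z' r -> height_gap z' z (- r).
Proof.
move=> [K zK]; exists K => k kK; have := zK _ kK.
by rewrite -rpredN => zk; apply: int_num_eq zk _; lra.
Qed.

Lemma height_gapD z z' z'' r r' :
  height_gap z z' r -> height_gap z' z'' r' -> height_gap z z'' (r + r').
Proof.
move=> [K zK] [K' zK']; exists (Num.min K K') => k kK.
have /zK zk : k <= K by lia.
have /zK' zk' : k <= K' by lia.
by apply: int_num_eq (rpredD zk zk') _; lra.
Qed.

Lemma height_gap_edge (i : int) z z' (e : edge (X i)) (t t' : R) :
  thread pr i z -> thread pr i z' ->
  z i = edge_point e t -> z' i = edge_point e t' ->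
  0 <= t <= 1 -> 0 <= t' <= 1 ->
  height_gap z z' (edge_length i * (t - t')).
Proof.
move=> zt zt' ze ze' t01 t'01; exists i => k ki.
have [f [s [s' [-> -> s01 s'01 <-]]]] :=
  thread_edge zt zt' ze ze' t01 t'01 ki.
rewrite mulrAC divff ?gt_eqF ?edge_length_gt0// mul1r.
apply: int_num_eq (rpredB (edge_param_edge_point f s01)
  (edge_param_edge_point f s'01)) _.
by lra.
Qed.

Lemma same_component_height_gap (k : int) (y y' : realization R (X k)) :
  same_component y y' -> forall z z', thread pr k z -> thread pr k z' ->
  z k = y -> z' k = y' -> exists r, height_gap z z' r.
Proof.
elim=> {y y'} [y y' [e [[t /= + <-] [t' /= + <-]]]|y|y y' _ IH|y y' y'' _ IH _ IH'] z z' zt zt'.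
- rewrite !in_itv /= => t01 t'01 zy zy'.
  by exists (edge_length k * (t - t')); exact: height_gap_edge zy zy' t01 t'01.
- move=> zy z'y; exists 0; apply: (height_gap_eventually (K := k)) (height_gap0 z) => //.
  by apply: thread_eq zt zt' _; rewrite zy.
- move=> zy zy'; have [r zr] := IH _ _ zt' zt zy' zy.
  by exists (- r); exact: height_gapN.
- move=> zy zy''; have [w wt wy] := thread_exists pr points y'.
  have [r zr] := IH _ _ zt wt zy wy; have [r' zr'] := IH' _ _ wt zt' wy zy''.
  by exists (r + r'); exact: height_gapD zr'.
Qed.

(** L is the length of a path from y to y'. It does not depend on j, so it becomes
small compared to edge_length j when j decreases. *)
Lemma same_component_tent (k : int) (y y' : realization R (X k)) :
  same_component y y' -> exists L : R,
  forall z z', thread pr k z -> thread pr k z' -> z k = y -> z' k = y' ->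
  forall j (v : vertex (X j)), j <= k ->
    edge_length j * `|tent v (z j) - tent v (z' j)| <= L.
Proof.
elim=> {y y'} [y y' [e [[t /= + <-] [t' /= + <-]]]|y|y y' _ [L IH]|y y' y'' _ [L IH] _ [L' IH']].
- rewrite !in_itv /= => t01 t'01; exists (edge_length k * `|t - t'|).
  by move=> z z' zt zt' zy zy' j v jk; exact: thread_tent zy zy' _ _ _ v _.
- exists 0 => z z' zt zt' zy z'y j v jk.
  by rewrite (thread_eq zt zt') ?zy// subrr normr0 mulr0.
- by exists L => z z' zt zt' zy zy' j v jk; rewrite distrC IH.
- exists (L + L') => z z' zt zt' zy zy'' j v jk.
  have [w wt wy] := thread_exists pr points y'.
  apply: le_trans (lerD (IH z w zt wt zy wy j v jk) (IH' w z' wt zt' wy zy'' j v jk)).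
  by rewrite -mulrDr ler_pM2l ?edge_length_gt0// ler_distD.
Qed.

Lemma height_gap_exists (i j : int) z z' : thread pr i z -> thread pr j z' ->
  exists r, height_gap z z' r.
Proof.
move=> zt zt'.
have [_ _ _ /(_ i j (z i) (z' j))[k kij [y [y' [zy zy' yy']]]]] := Xadm.
have [ki zk] := projects_to_thread zy zt erefl.
have [kj zk'] := projects_to_thread zy' zt' erefl.
exact: (same_component_height_gap yy' (threadW ki zt) (threadW kj zt')).
Qed.

(** * Existence and uniqueness of the height *)

Lemma height_system_exists :
  exists phi_ : forall i, realization R (X i) -> R, height_system m pr phi_.
Proof.
have [z0 z0t] : exists z, thread pr 0 z.
  by case: (points 0) => x; have [z zt _] := thread_exists pr points x; exists z.
have [thr thrP] : exists thr : forall i, realization R (X i) ->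
      forall k, realization R (X k),
    forall i x, thread pr i (thr i x) /\ thr i x i = x.
  exists (fun i x => projT1 (cid2 (thread_exists pr points x))) => i x.
  by case: (cid2 _).
have [phi_ phi_gap] : exists phi_ : forall i, realization R (X i) -> R,
    forall i x, height_gap (thr i x) z0 (phi_ i x).
  have gap i x := height_gap_exists (thrP i x).1 z0t.
  by exists (fun i x => projT1 (cid (gap i x))) => i x; case: (cid _).
have phiE i x z r : thread pr i z -> z i = x -> height_gap z z0 r -> phi_ i x = r.
  move=> zt zx zr; apply: height_gap_uniq (phi_gap i x) _.
  apply: (height_gap_eventually (K := i)) zr => // k ki.
  have [thrt thrx] := thrP i x.
  by apply: (thread_eq zt thrt) => //; rewrite zx thrx.
have phi_edge i (e : edge (X i)) t : 0 <= t <= 1 ->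
    phi_ i (edge_point e t) = edge_length i * t + phi_ i (Vertex R (src e)).
  move=> t01; have [zt zx] := thrP i (edge_point e t).
  have [zt' zx'] := thrP i (Vertex R (src e)).
  have z01 : 0 <= (0 : R) <= 1 by rewrite lexx ler01.
  have := height_gap_edge zt zt' zx (etrans zx' (esym (edge_point0 R e))) t01 z01.
  rewrite subr0 => gap_t; apply: phiE zt zx _.
  exact: height_gapD gap_t (phi_gap _ _).
have phi_tgt i (e : edge (X i)) :
    phi_ i (Vertex R (tgt e)) = edge_length i + phi_ i (Vertex R (src e)).
  by rewrite -edge_point1 phi_edge ?mulr1// lexx ler01.
exists phi_; split=> [i x|i e t t01|i e|i e].
- have [zt zx] := thrP (i + 1) x; have lt_i : i < i + 1 by lia.
  apply/esym; apply: phiE (threadW (ltW lt_i) zt) _ (phi_gap _ _).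
  by rewrite -zt// zx.
- by rewrite phi_edge// phi_tgt; lra.
- by rewrite phi_tgt ltrDr edge_length_gt0.
- by rewrite phi_tgt addrK gtr0_norm// edge_length_gt0.
Qed.

Section HeightSystem.
Variable phi_ : forall i : int, realization R (X i) -> R.
Hypothesis phi_height : height_system m pr phi_.

Lemma height_tgt (i : int) (e : edge (X i)) :
  phi_ (Vertex R (tgt e)) = phi_ (Vertex R (src e)) + edge_length i.
Proof.
have [_ _ lt_e /(_ i e)] := phi_height.
by rewrite gtr0_norm ?subr_gt0// /edge_length => <-; rewrite addrC subrK.
Qed.

Lemma height_edge_point (i : int) (e : edge (X i)) (t : R) : 0 <= t <= 1 ->
  phi_ (edge_point e t) = phi_ (Vertex R (src e)) + t * edge_length i.
Proof.
by have [_ lin _ _] := phi_height => t01; rewrite lin// height_tgt; ring.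
Qed.

Lemma height_projects_to (i k : int) (x : realization R (X i))
  (y : realization R (X k)) : projects_to pr x y -> phi_ x = phi_ y.
Proof. by have [comp _ _ _] := phi_height; elim=> {k y} // k y _ ->. Qed.

(** Loops are excluded because the height increases along edges; without this the
tent of a loop would be constant. *)
Lemma src_neq_tgt (i : int) (e : edge (X i)) : src e <> tgt e.
Proof. by have [_ _ /(_ i e) + _] := phi_height => + st; rewrite st ltxx. Qed.

Lemma height_star (i : int) (v : vertex (X i)) (a : realization R (X i)) :
  star v a -> `|phi_ a - phi_ (Vertex R v)| <= edge_length i.
Proof.
have len0 := edge_length_gt0 i.
case=> [->|[e ev [t /=]]]; first by rewrite subrr normr0 ltW.
rewrite in_itv /= => t01 <-; rewrite height_edge_point//.
have /andP[t0 t1] := t01.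
have tl0 : 0 <= t * edge_length i by rewrite mulr_ge0// ltW.
have tl1 : t * edge_length i <= edge_length i by rewrite ler_piMl// ltW.
by case: ev => <-; rewrite ?height_tgt ler_norml; lra.
Qed.

(** Inside the open star of v the tent measures the height above or below v, so it
is controlled by the height alone. *)
Lemma height_tent (i : int) (v : vertex (X i)) (a : realization R (X i)) :
  0 < tent v a ->
  edge_length i * tent v a = edge_length i - `|phi_ a - phi_ (Vertex R v)|.
Proof.
have len0 := edge_length_gt0 i.
case: a => [u|e t].
  rewrite /=; case: asboolP => [->|_]; last by rewrite ltxx.
  by rewrite subrr normr0 subr0 mulr1.
rewrite -edge_point_val height_edge_point ?inner_itv// edge_point_val.
have /andP[t0 t1] := inner_itv t; rewrite /=.
have [sv|_] := asboolP (src e = v).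
  rewrite asboolF => [_|tv]; last by apply: (@src_neq_tgt i e); rewrite sv.
  by rewrite sv addrAC subrr add0r ger0_norm ?mulr_ge0 ?(ltW len0)//=; ring.
have [<- _|_] := asboolP (tgt e = v); last by rewrite /= !mulr0 addr0 ltxx.
have -> : phi_ (Vertex R (src e)) + val t * edge_length i - phi_ (Vertex R (tgt e)) =
  - ((1 - val t) * edge_length i) by rewrite height_tgt; ring.
by rewrite normrN ger0_norm /= ?mulr_ge0 ?subr_ge0 ?(ltW len0)//; ring.
Qed.

End HeightSystem.

Lemma height_system_uniq phi_ psi_ :
  height_system m pr phi_ -> height_system m pr psi_ ->
  exists c : R, forall i x, psi_ i x = phi_ i x + c.
Proof.
move=> hphi hpsi; have [x0] := points 0.
exists (psi_ 0 x0 - phi_ 0 x0) => i x.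
have [_ _ _ /(_ i 0 x x0)[k _ [y [y' [xy xy' yy']]]]] := Xadm.
rewrite !(height_projects_to hphi xy) !(height_projects_to hpsi xy).
rewrite (height_projects_to hphi xy') (height_projects_to hpsi xy').
suff : psi_ k y - phi_ k y = psi_ k y' - phi_ k y' by lra.
elim: yy' => {y y' xy xy'} [y y' [e [[t /= + <-] [t' /= + <-]]]|//|y y' _ ->//|y y' y'' _ -> _ ->//].
rewrite !in_itv /= => t01 t'01.
by rewrite !(height_edge_point hphi)// !(height_edge_point hpsi)//; lra.
Qed.

(** * Bounds for the limit distance *)

Local Notation Xoo := (inverse_limit pr).

Lemma star_boundedP (d : Xoo -> Xoo -> R) :
  star_bounded m d <->
  forall i (v : vertex (X i)) x y,
    star v (limit_proj i x) -> star v (limit_proj i y) ->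
    d x y <= 2 * edge_length i.
Proof.
split=> [db i v x y xv yv|db i v].
  have /ereal_supP/(_ (d x y)%:E) := db i v; rewrite lee_fin; apply.
  by exists x => //; exists y.
by apply/ereal_supP => _ [x xv [y yv <-]]; rewrite lee_fin (db i v).
Qed.

Lemma fun_pseudo_distance (f : Xoo -> R) :
  pseudo_distance (fun x y => `|f x - f y|).
Proof.
split=> [x y|x|x y|x y z]; [exact: normr_ge0 | | exact: distrC | exact: ler_distD].
by rewrite subrr normr0.
Qed.

(** The factor 2 in the bound on stars is spent on passing through the value c at
the centre, so only distances from the centre have to be estimated. *)
Lemma fun_star_bounded (f : Xoo -> R) :
  (forall i (v : vertex (X i)), exists c, forall x,
     star v (limit_proj i x) -> `|f x - c| <= edge_length i) ->
  star_bounded m (fun x y => `|f x - f y|).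
Proof.
move=> fc; apply/star_boundedP => i v x y xv yv; have [c cP] := fc i v.
apply: le_trans (ler_distD c _ _) _; rewrite [`|c - _|]distrC.
by rewrite mulr_natl mulr2n lerD ?cP.
Qed.

(** This is what makes dbar the supremum of a bounded set. *)
Lemma common_star (x y : Xoo) : exists i (v : vertex (X i)),
  star v (limit_proj i x) /\ star v (limit_proj i y).
Proof.
have [_ _ _ /(_ 0 0 (limit_proj 0 x) (limit_proj 0 y))] := Xadm.
move=> [k _ [a [b [xa yb /same_component_tent[L tentL]]]]].
have [_ ka] := projects_to_thread xa (thread_proj (i := 0) x) erefl.
have [_ kb] := projects_to_thread yb (thread_proj (i := 0) y) erefl.
have [K LK] := edge_length_unbounded (2 * L).
pose j := Num.min k K; have [jk jK] : j <= k /\ j <= K by rewrite /j; split; lia.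
have [v v2] := near_vertex (limit_proj j x).
have tent_lt : `|tent v (limit_proj j x) - tent v (limit_proj j y)| < 1 / 2.
  have len0 := edge_length_gt0 j.
  rewrite -(ltr_pM2l len0).
  apply: le_lt_trans (tentL _ _ (thread_proj x) (thread_proj y) ka kb j v jk) _.
  by have := LK j jK; lra.
exists j, v; split; apply: tent_gt0_star; first by lra.
by move: tent_lt; rewrite ltr_norml; lra.
Qed.

Lemma dbar_ge (d : Xoo -> Xoo -> R) x y :
  pseudo_distance d -> star_bounded m d -> d x y <= dbar m pr x y.
Proof.
move=> dp db; apply: ub_le_sup; last by exists d.
have [i [v [xv yv]]] := common_star x y.
exists (2 * edge_length i) => _ [d' [_ /star_boundedP d'b] <-].
exact: d'b xv yv.
Qed.

Lemma dbar_le_star i (v : vertex (X i)) x y :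
  star v (limit_proj i x) -> star v (limit_proj i y) ->
  dbar m pr x y <= 2 * edge_length i.
Proof.
move=> xv yv; apply: ge_sup; last first.
  by move=> _ [d [_ /star_boundedP db] <-]; exact: db xv yv.
exists 0, (fun _ _ => 0) => //; split; first by split=> *; rewrite ?addr0.
apply/star_boundedP => j w _ _ _ _.
by rewrite mulr_ge0// ltW// edge_length_gt0.
Qed.

Lemma star_edge i (v : vertex (X i)) (a : realization R (X i)) : star v a ->
  a = Vertex R v \/ exists (e : edge (X i)) (t t' : R),
    [/\ a = edge_point e t, Vertex R v = edge_point e t',
        0 <= t <= 1, 0 <= t' <= 1 & `|t - t'| <= 1].
Proof.
case=> [->|[e ev [t /=]]]; first by left.
rewrite in_itv /= => t01 <-; right; exists e, t.
have /andP[t0 t1] := t01.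
case: ev => <-.
  by exists 0; rewrite edge_point0; split; rewrite ?lexx ?ler01 ?subr0 ?ger0_norm.
by exists 1; rewrite edge_point1; split; rewrite ?lexx ?ler01 ?ler_norml//; lra.
Qed.

(** Stars of X_j with j >= i are short, and a tent is Lipschitz along their edges;
stars of X_j with j < i are larger than the total range of the tent. *)
Lemma dbar_ge_tent i (v : vertex (X i)) x y :
  edge_length i * `|tent v (limit_proj i x) - tent v (limit_proj i y)|
    <= dbar m pr x y.
Proof.
have len0 := edge_length_gt0 i.
pose f (x : Xoo) := edge_length i * tent v (limit_proj i x).
have -> : edge_length i * `|tent v (limit_proj i x) - tent v (limit_proj i y)| =
    `|f x - f y| by rewrite -mulrBr normrM gtr0_norm.
apply: (@dbar_ge (fun x y => `|f x - f y|)); first exact: fun_pseudo_distance.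
apply: fun_star_bounded => j w.
have [ji|/ltW ij] := leP j i.
  exists 0 => z _; rewrite subr0; apply: le_trans (edge_length_le ji).
  have /andP[t0 t1] := tent_itv v (limit_proj i z).
  by rewrite ger0_norm ?ler_piMr ?mulr_ge0// ltW.
(* The centre w may have no lift to the limit, so its thread is used instead. *)
have [s st sw] := thread_exists pr points (Vertex R w).
exists (edge_length i * tent v (s i)) => z /star_edge.
rewrite /f -mulrBr normrM gtr0_norm//.
move=> [zw|[e [t [t' [zt wt' t01 t'01 tt']]]]].
  by rewrite (thread_eq (thread_proj z) st _ ij) ?sw// subrr normr0 mulr0 ltW ?edge_length_gt0.
rewrite -sw in wt'.
apply: le_trans (thread_tent (thread_proj z) st zt wt' t01 t'01 v ij) _.
by rewrite ler_piMr// ltW// edge_length_gt0.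
Qed.

(** A chain of steps of length at most r over I starts deep in the open star of v
and, by the height bound, stays deep in it. *)
Lemma component_star i phi_ (phi : Xoo -> R) (r : R) (x y : Xoo) (I : set R) :
  height_system m pr phi_ ->
  (forall x, phi x = phi_ i (limit_proj i x)) ->
  (forall a b, I a -> I b -> `|a - b| <= r) -> 4 * r < edge_length i ->
  forall v, 1 / 2 <= tent v (limit_proj i x) ->
  delta_component (dbar m pr) r%:E (phi @^-1` I) x y ->
  star v (limit_proj i y).
Proof.
move=> hphi phiE Ir r4 v v2 [n [z [zx <- zI zr]]].
have len0 := edge_length_gt0 i.
set l := edge_length i in r4 len0 *.
have hx : `|phi_ i (limit_proj i x) - phi_ i (Vertex R v)| <= l / 2.
  have := height_tent hphi (v := v) (a := limit_proj i x); rewrite -/l => hE.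
  have : l * (1 / 2) <= l * tent v (limit_proj i x) by rewrite ler_pM2l.
  by rewrite hE; lra.
apply: tent_gt0_star.
have step k : (k <= n)%N -> 0 < tent v (limit_proj i (z k)).
  elim: k => [_|k IH kn]; first by rewrite zx; lra.
  have kn' : (k <= n)%N by lia.
  have := height_tent hphi (IH kn'); rewrite -/l => hE.
  have hz := Ir _ _ (zI _ kn') (zI 0%N isT); rewrite /= zx !phiE in hz.
  have drop : l * (tent v (limit_proj i (z k)) - tent v (limit_proj i (z k.+1))) <= r.
    have := zr k kn; rewrite lee_fin; apply: le_trans.
    by apply: le_trans (dbar_ge_tent v _ _); rewrite ler_pM2l// ler_norm.
  have hD := ler_distD (phi_ i (limit_proj i x)) (phi_ i (limit_proj i (z k)))
    (phi_ i (Vertex R v)).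
  by rewrite -(pmulr_rgt0 _ len0); rewrite mulrBr in drop; lra.
exact: step.
Qed.

Lemma height_limit phi_ (x : Xoo) i j : height_system m pr phi_ ->
  phi_ i (limit_proj i x) = phi_ j (limit_proj j x).
Proof.
case=> comp _ _ _.
wlog ij : i j / i <= j; first by move=> H; case/orP: (le_total i j) => /H.
apply: (int_descending_ind (P := fun k =>
  phi_ k (limit_proj k x) = phi_ j (limit_proj j x))) ij => // k _ <-.
by rewrite comp (svalP x).
Qed.

Lemma height_lipschitz phi_ (phi : Xoo -> R) x y : height_system m pr phi_ ->
  (forall i x, phi x = phi_ i (limit_proj i x)) ->
  `|phi x - phi y| <= dbar m pr x y.
Proof.
move=> hphi phiE; apply: (@dbar_ge (fun x y => `|phi x - phi y|)).
  exact: fun_pseudo_distance.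
apply: fun_star_bounded => i v; exists (phi_ i (Vertex R v)) => z zv.
by rewrite (phiE i); exact: height_star.
Qed.

Lemma component_diam phi_ (phi : Xoo -> R) (r : R) (x y y' : Xoo) (I : set R) :
  height_system m pr phi_ -> (forall i x, phi x = phi_ i (limit_proj i x)) ->
  0 <= r -> (forall a b, I a -> I b -> `|a - b| <= r) ->
  delta_component (dbar m pr) r%:E (phi @^-1` I) x y ->
  delta_component (dbar m pr) r%:E (phi @^-1` I) x y' ->
  dbar m pr y y' <= 8 * m%:R * r.
Proof.
move=> hphi phiE r0 Ir xy xy'; apply/ler_addgt0Pr => eps eps0.
have m0 : 0 < m%:R :> R by rewrite ltr0n; lia.
(* Slightly more than 4 r, so that r = 0 is covered and the inequality
   4 r < edge_length i is strict. *)
pose s := 4 * r + eps / (2 * m%:R).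
have eps_s : 0 < eps / (2 * m%:R) by rewrite divr_gt0// mulr_gt0.
have [i /andP[si im]] : exists i, s <= edge_length i < m%:R * s.
  by apply: edge_length_bracket; rewrite /s; lra.
have [v v2] := near_vertex (limit_proj i x).
have r4 : 4 * r < edge_length i by rewrite /s in si; lra.
have yv := component_star hphi (phiE i) Ir r4 v2 xy.
have y'v := component_star hphi (phiE i) Ir r4 v2 xy'.
apply: le_trans (dbar_le_star yv y'v) _.
have -> : 8 * m%:R * r + eps = 2 * (m%:R * s).
  by rewrite /s; field; rewrite gt_eqF.
by rewrite ler_pM2l// ltW.
Qed.

End System.

(** * The height map of the inverse limit *)

Theorem theorem1p10 (R : realType) (m : nat) (X : int -> digraph)
  (pr : forall i : int, realization R (X (i + 1)) -> realization R (X i))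
  (Xadm : admissible pr m) :
  exists phi_ : forall i : int, realization R (X i) -> R,
    [/\ height_system m pr phi_,
        forall psi_ : forall i : int, realization R (X i) -> R,
          height_system m pr psi_ ->
          exists c : R, forall i x, psi_ i x = phi_ i x + c
      & exists phi : inverse_limit pr -> R,
          [/\ forall i x, phi x = phi_ i (limit_proj i x),
              forall x y, `|phi x - phi y| <= dbar m pr x y
            & exists2 C : R, 0 < C &
              forall I : set R, is_interval I ->
              forall x, (phi @^-1` I) x ->
                let delta := diam (fun a b : R => `|a - b|) I in
                (diam (dbar m pr)
                   (delta_component (dbar m pr) delta (phi @^-1` I) x)
                 <= C%:E * delta)%E]].
Proof.
have [phi_ hphi] := height_system_exists Xadm.
exists phi_; split=> // [psi_ hpsi|]; first exact (height_system_uniq Xadm hphi hpsi).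
pose phi (x : inverse_limit pr) := phi_ 0 (limit_proj 0 x).
have phiE i x : phi x = phi_ i (limit_proj i x) by exact: height_limit hphi.
exists phi; split=> // [x y|]; first exact: (height_lipschitz Xadm x y hphi phiE).
have [m_ge2 _ _ _] := Xadm.
have C0 : 0 < 8 * m%:R :> R by rewrite mulr_gt0// ltr0n; lia.
exists (8 * m%:R) => // I _ x Ix.
set delta := diam _ I.
have delta_ub a b : I a -> I b -> (`|a - b|%:E <= delta)%E.
  by move=> Ia Ib; apply: ereal_sup_ubound; exists a => //; exists b.
have delta0 : (0 <= delta)%E.
  by have := delta_ub _ _ Ix Ix; rewrite subrr normr0.
apply: ge_ereal_sup => _ [y xy [y' xy' <-]].
case: delta delta_ub delta0 xy xy' => [r| |] // delta_ub r0 xy xy'.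
- rewrite -EFinM lee_fin; rewrite lee_fin in r0.
  by apply: (component_diam Xadm hphi phiE r0 _ xy xy') => a b Ia Ib;
     have := delta_ub a b Ia Ib; rewrite lee_fin.
- by rewrite gt0_muley ?lte_fin// leey.
Qed.
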